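(* Let $d\ge 2$ and let $Q'=C\ell(e^0,e^1,e^2,e^3,e^5,e^7,\dots,e^{2d-1})\subset C\ell_{1,2d-1}$ be the subalgebra generated by the listed generators, $I=-e^1e^2$, $E=e^0$. Let $P=(p^\mu_\nu)\in\mathrm{O}(1,2d-1)$, $Q=(q^\nu_\mu)=P^{-1}$, and define ($\mu,\nu=0,\dots,2d-1$) $$\widehat{x^\mu}=p^\mu_\nu x^\nu,\qquad \widehat\partial_\mu=q^\nu_\mu\partial_\nu,\qquad \widehat a_\mu=q^\nu_\mu a_\nu,\qquad \widehat{e^\mu}=e^\mu .$$ Let $S\in\mathrm{Pin}(1,2d-1)$ be related to $P$ by $S^{-1}e^\mu S=p^\mu_\nu e^\nu$ for $\mu=0,\dots,2d-1$, and write $$S=S^0+\sum_k S_{\mu_1\mu_2\ldots\mu_k}e^{\mu_1\mu_2\ldots\mu_k}$$ for its decomposition with coefficients in $Q'$ described in the context. Suppose that $\Psi:\mathbb{R}^{1,2d-1}\to Q'^{(0)}$ is a solution of the Dirac--Hestenes equation $$\sum_{\mu=0,1,2,3,5,7,\dots,2d-1}e^\mu(\partial_\mu\Psi+\Psi a_\mu I)E+\sum_{\mu=3,5,\dots,2d-3}(\partial_{\mu+1}\Psi+\Psi a_{\mu+1}I)e^\mu EI+m\Psi I=0 .$$ (i) If $S\in\mathrm{Spin}(1,2d-1)$, then the function $$\widehat\Psi=S^0\Psi+\sum_k S_{\mu_1\mu_2\ldots\mu_k}\Psi\, e^{\mu_1-1\,\mu_2-1\,\ldots\,\mu_k-1}I^k$$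 is a solution of the transformed Dirac--Hestenes equation $$\sum_{\mu=0,1,2,3,5,7,\dots,2d-1}\widehat{e^\mu}\,\widehat A_\mu E+\sum_{\mu=3,5,\dots,2d-3}\widehat A_{\mu+1}I\,\widehat{e^\mu}E+m\widehat\Psi I=0,\qquad \widehat A_\mu:=\widehat\partial_\mu\widehat\Psi+\widehat\Psi\,\widehat a_\mu I .\qquad( * )$$ (ii) If $S\in\mathrm{Pin}(1,2d-1)\setminus\mathrm{Spin}(1,2d-1)$, then the function $$\widehat\Psi=S^0\Psi E+\sum_k S_{\mu_1\mu_2\ldots\mu_k}\Psi\, e^{\mu_1-1\,\mu_2-1\,\ldots\,\mu_k-1}I^kE$$ is a solution of the transformed Dirac--Hestenes equation $( * )$.
   Context: $C\ell_{1,n}$ is the real Clifford algebra with identity $e$ and generators $e^0,\dots,e^n$ satisfying $e^\mu e^\nu+e^\nu e^\mu=2\eta^{\mu\nu}e$, $\eta=\mathrm{diag}(1,-1,\dots,-1)$; here $n=2d-1$. $C\ell^{(0)}_{1,n}$ and $C\ell^{(1)}_{1,n}$ are the spans of products of an even, resp. odd, number of distinct generators; $C\ell^1_{1,n}$ is the span of the generators; a superscript $\times$ denotes invertible elements; $e^{\nu_1\nu_2\ldots\nu_k}=e^{\nu_1}e^{\nu_2}\cdots e^{\nu_k}$. For a subalgebra $Q'$ generated by some of the generators, $Q'^{(0)}=Q'\cap C\ell^{(0)}_{1,n}$ and $Q'^{(1)}=Q'\cap C\ell^{(1)}_{1,n}$. $\widetilde U$ denotes reversion (the linear anti-automorphism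 fixing the generators). $$\mathrm{Pin}(1,n)=\{T\in C\ell^{(0)\times}_{1,n}\cup C\ell^{(1)\times}_{1,n}:\ TxT^{-1}\in C\ell^1_{1,n}\ \forall x\in C\ell^1_{1,n},\ T^{-1}=\pm\widetilde T\},$$ and $\mathrm{Spin}(1,n)=\mathrm{Pin}(1,n)\cap C\ell^{(0)}_{1,n}$. $\mathrm{O}(1,n)=\{A\in\mathrm{Mat}(n+1,\mathbb{R}):A^\top\eta A=\eta\}$. In $p^\mu_\nu$ and $q^\nu_\mu$ the upper index is the row index and the lower one the column index, so $q^\alpha_\mu p^\mu_\nu=\delta^\alpha_\nu$; repeated indices are summed. Decomposition of $S$: every $S\in C\ell_{1,n}$ is written uniquely as $S=S^0+\sum_{k\ge1}\sum_{\mu_1<\dots<\mu_k}S_{\mu_1\ldots\mu_k}e^{\mu_1\ldots\mu_k}$, where $\mu_1,\dots,\mu_k$ run over the indices of generators not among those generating $Q'$ (here $\mu_i\in\{4,6,\dots,2d-2\}$) and $S^0,S_{\mu_1\ldots\mu_k}\in Q'$. For $S$ even, $S^0\in Q'^{(0)}$ and $S_{\mu_1\ldots\mu_k}$ is in $Q'^{(0)}$ for $k$ even and in $Q'^{(1)}$ for $k$ odd; for $S$ odd these parities are reversed. The sum $\sum_k$ in the statement is over all such increasing multi-indices, and $e^{\mu_1-1\,\ldots\,\mu_k-1}=e^{\mu_1-1}\cdots e^{\mu_k-1}$. $\mathbb{R}^{1,n}$ is $\mathbb{R}^{n+1}$ with coordinates $x^0,\dots,x^n$ and metric $\eta$; $\partial_\mu=\partial/\partial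 x^\mu$; $m$ is a real constant (mass); $\mathbf a=(a_0,\dots,a_n):\mathbb{R}^{1,n}\to\mathbb{R}^{n+1}$ is a given vector-potential; $\Psi$ is differentiable. Untransformed functions are evaluated at $x$ and hatted functions at $\widehat x=Px$ (e.g. $\widehat a_\mu(\widehat x)=q^\nu_\mu a_\nu(x)$, and $\widehat\Psi(\widehat x)$ is given by the formula with $\Psi=\Psi(x)$); $\widehat\partial_\mu=\partial/\partial\widehat{x^\mu}$. *)

(* Defs.v *)
From HB Require Import structures.
From mathcomp Require Import all_boot all_order all_algebra all_field.
From mathcomp Require Import ring zify.

Set Implicit Arguments.
Unset Strict Implicit.
Unset Printing Implicit Defensive.

Import GRing.Theory.
Local Open Scope ring_scope.

(* The Clifford algebra of signature (1, n), realized as the twisted group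
   algebra of the Boolean group of subsets of {0, .., n}: the value of
   T : clifford R n at A is the coefficient of T at the ordered product
   e^{i_1} e^{i_2} .. (i_1 < i_2 < ..) of the generators with index in A. *)

Definition minkowski (R : fieldType) n (i : 'I_n.+1) : R :=
  if i == 0 then 1 else -1.

Definition minkowski_mx (R : fieldType) n : 'M[R]_n.+1 :=
  \matrix_(i, j) if i == j then minkowski R i else 0.

Definition clifford (R : fieldType) (n : nat) : Type :=
  {ffun {set 'I_n.+1} -> R^o}.

HB.instance Definition _ (R : fieldType) n := Choice.on (clifford R n).
HB.instance Definition _ (R : fieldType) n := Vector.on (clifford R n).

Section SymDiff.
Variable T : finType.
Implicit Types A B C : {set T}.

Definition symdiff A B : {set T} := [set i | (i \in A) (+) (i \in B)].

Lemma in_symdiff A B i : (i \in symdiff A B) = (i \in A) (+) (i \in B).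
Proof. by rewrite inE. Qed.

Lemma symdiffA : associative symdiff.
Proof. by move=> A B C; apply/setP=> i; rewrite !in_symdiff addbA. Qed.

Lemma symdiffC : commutative symdiff.
Proof. by move=> A B; apply/setP=> i; rewrite !in_symdiff addbC. Qed.

Lemma symdiff0s : left_id set0 symdiff.
Proof. by move=> A; apply/setP=> i; rewrite !inE. Qed.

Lemma symdiffs0 : right_id set0 symdiff.
Proof. by move=> A; rewrite symdiffC symdiff0s. Qed.

Lemma symdiffss A : symdiff A A = set0.
Proof. by apply/setP=> i; rewrite !inE addbb. Qed.

Lemma symdiffK A : involutive (symdiff A).
Proof. by move=> B; rewrite symdiffA symdiffss symdiff0s. Qed.

End SymDiff.

Section Clifford.
Variables (R : fieldType) (n : nat).
Local Notation Cl := (clifford R n).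
Implicit Types (A B C : {set 'I_n.+1}) (x y z : Cl).

(* The sign produced by moving e^j to the left across e^i (or by contracting
   e^i e^i), when e^j comes from the right factor. *)
Definition gen_sign (i j : 'I_n.+1) : R :=
  if (j < i)%N then -1 else if i == j then minkowski R i else 1.

Definition blade_sign A B : R := \prod_(i in A) \prod_(j in B) gen_sign i j.

Definition cl_one : Cl := [ffun A => (A == set0)%:R].

Definition cl_mul x y : Cl :=
  [ffun C => \sum_A blade_sign A (symdiff A C) * x A * y (symdiff A C)].

Lemma gen_sign_sq i j : gen_sign i j * gen_sign i j = 1.
Proof.
rewrite /gen_sign /minkowski.
by do 3?case: ifP => _; rewrite ?mulrNN mulr1.
Qed.

Lemma prod_symdiff (f : 'I_n.+1 -> R) A B : (forall i, f i * f i = 1) ->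
  \prod_(i in symdiff A B) f i = (\prod_(i in A) f i) * \prod_(i in B) f i.
Proof.
move=> ff; rewrite !(big_mkcond (fun i => i \in _)) -big_split /=.
apply: eq_bigr => i _; rewrite in_symdiff.
by case: (i \in A); case: (i \in B); rewrite /= ?ff ?mulr1 ?mul1r.
Qed.

Lemma blade_sign_sq A B : blade_sign A B * blade_sign A B = 1.
Proof.
rewrite -big_split big1 // => i _; rewrite -big_split big1 // => j _.
exact: gen_sign_sq.
Qed.

Lemma blade_signDl A B C :
  blade_sign (symdiff A B) C = blade_sign A C * blade_sign B C.
Proof.
rewrite {1}/blade_sign prod_symdiff // => i.
by rewrite -big_split big1 // => j _; apply: gen_sign_sq.
Qed.

Lemma blade_signDr A B C :
  blade_sign A (symdiff B C) = blade_sign A B * blade_sign A C.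
Proof.
rewrite -big_split; apply: eq_bigr => i _.
by apply: prod_symdiff => j; apply: gen_sign_sq.
Qed.

Lemma blade_sign0l A : blade_sign set0 A = 1.
Proof. by rewrite /blade_sign big_set0. Qed.

Lemma blade_sign0r A : blade_sign A set0 = 1.
Proof. by rewrite /blade_sign big1 // => i _; rewrite big_set0. Qed.

Lemma cl_mulA : associative cl_mul.
Proof.
move=> x y z; apply/ffunP=> D; rewrite !ffunE.
under eq_bigr => A _ do rewrite ffunE mulr_sumr.
under [RHS]eq_bigr => C _ do rewrite ffunE mulr_sumr mulr_suml.
rewrite [RHS]exchange_big; apply: eq_bigr => A _ /=.
rewrite (reindex_inj (inv_inj (symdiffK A))) /=; apply: eq_bigr => C _.
have -> : symdiff (symdiff A C) (symdiff A D) = symdiff C D.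
  by rewrite (symdiffC A C) -symdiffA symdiffK.
have -> : blade_sign C (symdiff C D) =
    blade_sign A (symdiff C D) * blade_sign (symdiff A C) (symdiff C D).
  by rewrite blade_signDl mulrA blade_sign_sq mul1r.
have -> : blade_sign A (symdiff A D) =
    blade_sign A (symdiff A C) * blade_sign A (symdiff C D).
  by rewrite -blade_signDr symdiffA -[symdiff (symdiff A C) C]symdiffA
    symdiffss symdiffs0.
set s1 := blade_sign A _; set s2 := blade_sign A _; set s3 := blade_sign _ _.
ring.
Qed.

Lemma cl_mul1l : left_id cl_one cl_mul.
Proof.
move=> x; apply/ffunP=> C; rewrite ffunE (bigD1 set0) //= big1 => [|A nA0].
  by rewrite ffunE eqxx symdiff0s blade_sign0l !mul1r addr0.
by rewrite ffunE (negPf nA0) mulr0 mul0r.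
Qed.

Lemma cl_mul1r : right_id cl_one cl_mul.
Proof.
move=> x; apply/ffunP=> C; rewrite ffunE (bigD1 C) //= big1 => [|A nAC].
  by rewrite ffunE symdiffss eqxx blade_sign0r mul1r mulr1 addr0.
rewrite ffunE; case: eqP => [AC|_]; last by rewrite mulr0.
by case/eqP: nAC; rewrite -[A]symdiffs0 -AC symdiffK.
Qed.

Lemma cl_mulDl : left_distributive cl_mul +%R.
Proof.
move=> x y z; apply/ffunP=> C; rewrite !ffunE -big_split.
by apply: eq_bigr => A _; rewrite ffunE mulrDr mulrDl.
Qed.

Lemma cl_mulDr : right_distributive cl_mul +%R.
Proof.
move=> x y z; apply/ffunP=> C; rewrite !ffunE -big_split.
by apply: eq_bigr => A _; rewrite ffunE mulrDr.
Qed.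

Lemma cl_one_neq0 : cl_one != 0.
Proof.
by apply/eqP=> /ffunP/(_ set0)/eqP; rewrite !ffunE eqxx oner_eq0.
Qed.

HB.instance Definition _ := GRing.Zmodule_isNzRing.Build Cl
  cl_mulA cl_mul1l cl_mul1r cl_mulDl cl_mulDr cl_one_neq0.

Lemma cl_scaleAl (a : R) x y : a *: (x * y) = (a *: x) * y.
Proof.
apply/ffunP=> C; rewrite !ffunE scaler_sumr; apply: eq_bigr => A _.
by rewrite ffunE -[a *: x A]/(a * x A) -[LHS]/(a * _) !mulrA [a * _]mulrC.
Qed.

HB.instance Definition _ := GRing.Lmodule_isLalgebra.Build R Cl cl_scaleAl.

Lemma cl_scaleAr (a : R) x y : a *: (x * y) = x * (a *: y).
Proof.
apply/ffunP=> C; rewrite !ffunE scaler_sumr; apply: eq_bigr => A _.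
by rewrite ffunE -[a *: y _]/(a * y _) -[LHS]/(a * _) mulrCA.
Qed.

HB.instance Definition _ := GRing.Lalgebra_isAlgebra.Build R Cl cl_scaleAr.
HB.instance Definition _ := Algebra_isFalgebra.Build R Cl.

Definition basis_blade A : Cl := [ffun B => (B == A)%:R].

Definition gen (i : 'I_n.+1) : Cl := basis_blade [set i].

Definition blade A : Cl := \prod_(i in A) gen i.

Lemma basis_bladeM A B :
  basis_blade A * basis_blade B = blade_sign A B *: basis_blade (symdiff A B).
Proof.
apply/ffunP=> C; rewrite !ffunE (bigD1 A) //= big1 => [|D nDA].
  rewrite !ffunE eqxx mulr1 addr0 -[RHS]/(_ * _).
  rewrite (can2_eq (symdiffK A) (symdiffK A)).
  by case: eqP => [->|_]; rewrite ?mulr0 ?symdiffK.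
by rewrite !ffunE (negPf nDA) mulr0 mul0r.
Qed.

Lemma basis_blade0 : basis_blade set0 = 1.
Proof. by []. Qed.

Lemma sum_basis_blade x : x = \sum_A (x A : R) *: basis_blade A.
Proof.
apply/ffunP=> B; rewrite sum_ffunE (bigD1 B) //= big1 => [|A nAB].
  by rewrite !ffunE eqxx addr0 -[RHS]/(_ * _) mulr1.
by rewrite !ffunE eq_sym (negPf nAB) scaler0.
Qed.

Lemma prod_gen_sorted (s : seq 'I_n.+1) :
  sorted (fun i j : 'I_n.+1 => (i < j)%N) s ->
  \prod_(i <- s) gen i = basis_blade [set i in s].
Proof.
elim: s => [|i s IHs] ps.
  by rewrite big_nil -[LHS]basis_blade0; congr basis_blade; apply/setP=> i; rewrite !inE.
rewrite big_cons IHs ?(path_sorted ps) // basis_bladeM.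
have /allP lt_is : all (fun j : 'I_n.+1 => (i < j)%N) s.
  by apply: order_path_min ps => j k l; apply: ltn_trans.
rewrite {1}/blade_sign big_set1 big1 ?scale1r => [|j].
  congr basis_blade; apply/setP=> j; rewrite !inE.
  by case: eqP => //= ->; case: (boolP (i \in s)) => // /lt_is; rewrite ltnn.
rewrite inE => /lt_is ltij; rewrite /gen_sign ltnNge ltnW //=.
by case: eqP => // eij; rewrite eij ltnn in ltij.
Qed.

Lemma bladeE A : blade A = basis_blade A.
Proof.
rewrite /blade -big_filter deprecated_filter_index_enum prod_gen_sorted.
  by congr basis_blade; apply/setP=> i; rewrite inE mem_enum.
rewrite /enum_mem; apply: sorted_filter => [j i k|]; first exact: ltn_trans.
have: sorted ltn (map val (enum 'I_n.+1)) by rewrite val_enum_ord iota_ltn_sorted.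
by rewrite sorted_map enumT.
Qed.

Lemma gen_anticomm i j :
  gen i * gen j + gen j * gen i
  = (2%:R * minkowski_mx R n i j) *: (1 : Cl).
Proof.
have sE k l : blade_sign [set k] [set l] = gen_sign k l.
  by rewrite /blade_sign !big_set1.
rewrite !basis_bladeM [symdiff [set j] _]symdiffC -scalerDl !sE !mxE /gen_sign.
have [->|ne_ij] := eqVneq i j.
  by rewrite ltnn symdiffss basis_blade0 mulr_natl mulr2n.
rewrite mulr0 scale0r.
have /orP[lt_ij|lt_ji] : (i < j)%N || (j < i)%N by rewrite -neq_ltn.
  by rewrite lt_ij ltnNge ltnW //= subrr scale0r.
by rewrite lt_ji ltnNge ltnW //= addNr scale0r.
Qed.

(* The standard closed formula for reversion: reordering the reversed product
   of k distinct generators costs k(k-1)/2 transpositions; see [reversionM]. *)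
Definition reversion x : Cl :=
  [ffun A : {set 'I_n.+1} => (-1) ^+ 'C(#|A|, 2) * x A].

Lemma reversion_linear : linear reversion.
Proof.
move=> a x y; apply/ffunP=> A; rewrite !ffunE mulrDr; congr (_ + _).
by rewrite -[a *: x A]/(a * x A) -[RHS]/(a * _) mulrCA.
Qed.

Lemma reversion_gen i : reversion (gen i) = gen i.
Proof.
apply/ffunP=> A; rewrite !ffunE; case: eqP => [->|_]; last by rewrite mulr0.
by rewrite cards1 mul1r.
Qed.

Lemma blade_sign_swap A B :
  blade_sign B A = (-1) ^+ (#|A| * #|B| + #|A :&: B|) * blade_sign A B.
Proof.
have s_swap i j : gen_sign j i = (-1) ^+ (i != j) * gen_sign i j.
  rewrite /gen_sign; have [->|ne_ij] := eqVneq i j; first by rewrite mul1r.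
  rewrite expr1.
  have /orP[lt_ij|lt_ji] : (i < j)%N || (j < i)%N by rewrite -neq_ltn.
    by rewrite lt_ij [(j < i)%N]ltnNge ltnW //= mulr1.
  by rewrite lt_ji [(i < j)%N]ltnNge ltnW //= mulrNN mulr1.
have inner i : \prod_(j in B) (-1 : R) ^+ (i != j) = (-1) ^+ (#|B| + (i \in B)).
  have -> : (#|B| + (i \in B) = #|B :\ i| + 2 * (i \in B))%N.
    by rewrite (cardsD1 i B); lia.
  rewrite exprD exprM sqrrN expr1n expr1n mulr1 -prodr_const.
  rewrite [LHS]big_mkcond [RHS]big_mkcond /=; apply: eq_bigr => j _.
  by rewrite !inE eq_sym; case: (j \in B); case: (j == i).
rewrite /blade_sign exchange_big /=.
under eq_bigr => i _ do under eq_bigr => j _ do rewrite s_swap.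
under eq_bigr => i _ do rewrite big_split /= inner exprD.
rewrite big_split /= big_split /= prodr_const -exprM mulnC exprD.
congr (_ * _ * _); rewrite -prodr_const [LHS]big_mkcond [RHS]big_mkcond /=.
by apply: eq_bigr => i _; rewrite inE; case: (i \in A); case: (i \in B).
Qed.

Lemma card_symdiff A B : (#|symdiff A B| + 2 * #|A :&: B| = #|A| + #|B|)%N.
Proof.
rewrite -!sum1_card !(big_mkcond (fun i => i \in _)) big_distrr -!big_split /=.
apply: eq_bigr => i _; rewrite in_symdiff inE.
by case: (i \in A); case: (i \in B).
Qed.

Lemma bin2D k l : 'C(k + l, 2) = ('C(k, 2) + 'C(l, 2) + k * l)%N.
Proof.
elim: l => [|l IHl]; first by rewrite !addn0 muln0 addn0.
by rewrite addnS !binS !bin1 IHl mulnS; lia.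
Qed.

Lemma reversion_sign A B :
  (-1 : R) ^+ 'C(#|symdiff A B|, 2) =
  (-1) ^+ 'C(#|A|, 2) * (-1) ^+ 'C(#|B|, 2) *
  (-1) ^+ (#|A| * #|B| + #|A :&: B|).
Proof.
have := congr1 (fun k => 'C(k, 2)) (card_symdiff A B).
rewrite /= mul2n -addnn !bin2D -!exprD => eC.
move: eC; set s := #|symdiff A B|; set c := #|A :&: B|.
set X := 'C(s, 2); set Y := 'C(c, 2).
set U := 'C(#|A|, 2); set V := 'C(#|B|, 2).
move=> eC; have c2 : (c <= c * c)%N by case: (c) => // k; rewrite leq_pmull.
have ch : (c * c - c = 2 * (c * c - c)./2)%N.
  by rewrite mul2n even_halfK // oddB ?oddM ?andbb ?addbb.
move: (c * c - c)./2 ch => h ch.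
rewrite mulnDr in eC.
have -> : (U + V + (#|A| * #|B| + c) = X + 2 * (Y + s * c + h + c))%N.
  clearbody s c X Y U V; move: (s * c)%N (c * c)%N (#|A| * #|B|)%N eC c2 ch.
  by move=> sc cc ab; lia.
by rewrite [RHS]exprD exprM sqrrN !expr1n mulr1.
Qed.

Lemma reversionM x y : reversion (x * y) = reversion y * reversion x.
Proof.
apply/ffunP=> C; rewrite !ffunE mulr_sumr.
rewrite [RHS](reindex_inj (inv_inj (symdiffK C))) /=.
apply: eq_bigr => A _; rewrite !ffunE.
set B := symdiff C A; have -> : symdiff B C = A.
  by rewrite /B symdiffC symdiffK.
have -> : symdiff A C = B by rewrite symdiffC.
have -> : C = symdiff A B by rewrite /B symdiffC -symdiffA symdiffss symdiffs0.
rewrite reversion_sign (blade_sign_swap A B).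
move: (blade_sign A B) => s.
ring.
Qed.

Definition parity_part (b : bool) : {vspace Cl} :=
  <<[seq blade A | A <- enum [pred A : {set 'I_n.+1} | odd #|A| == b]]>>%VS.

Definition even_part := parity_part false.
Definition odd_part := parity_part true.

Definition vector_part : {vspace Cl} :=
  <<[seq gen i | i <- enum 'I_n.+1]>>%VS.

Definition in_pin (T : Cl) : Prop :=
  [/\ T \is a GRing.unit,
      T \in even_part \/ T \in odd_part,
      forall x, x \in vector_part -> T * x * T^-1 \in vector_part
    & T^-1 = reversion T \/ T^-1 = - reversion T].

Definition in_spin (T : Cl) : Prop := in_pin T /\ T \in even_part.

End Clifford.

Definition in_lorentz (R : fieldType) n (P : 'M[R]_n.+1) : Prop :=
  P^T *m minkowski_mx R n *m P = minkowski_mx R n.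

Lemma lorentz_unit (R : fieldType) n (P : 'M[R]_n.+1) :
  in_lorentz P -> P \in unitmx.
Proof.
move=> PO; have eta2 : minkowski_mx R n *m minkowski_mx R n = 1%:M.
  apply/matrixP=> i j; rewrite !mxE (bigD1 i) //= big1 => [|k nki].
    rewrite !mxE eqxx addr0; case: eqP => _; last by rewrite mulr0.
    by rewrite /minkowski; case: ifP; rewrite ?mulrNN mulr1.
  by rewrite !mxE eq_sym (negPf nki) mul0r.
have /mulmx1_unit[_ //] : (minkowski_mx R n *m P^T *m minkowski_mx R n) *m P = 1%:M.
by rewrite -!mulmxA [P^T *m _]mulmxA PO eta2.
Qed.

Section Hestenes.
Variables (R : fieldType) (d : nat).
Local Notation n := (2 * d - 1)%N.
Local Notation Cl := (clifford R n).

(* mu in {0, 1, 2, 3, 5, 7, .., 2d-1} *)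
Definition qindex (mu : 'I_n.+1) : bool := (mu <= 3)%N || odd mu.

(* mu in {3, 5, .., 2d-3} *)
Definition mid_index (mu : 'I_n.+1) : bool :=
  [&& (3 <= mu)%N, (mu <= 2 * d - 3)%N & odd mu].

(* Nonempty increasing multi-indices mu_1 < .. < mu_k with entries outside
   [qindex], encoded as sets. *)
Definition multi_index (M : {set 'I_n.+1}) : bool :=
  (M != set0) && [forall mu in M, ~~ qindex mu].

Definition qalg : {vspace Cl} :=
  agenv <<[seq gen R mu | mu <- enum qindex]>>%VS.

Definition qalg_even : {vspace Cl} := (qalg :&: even_part R n)%VS.

Definition elt_I : Cl := - (gen R (inord 1) * gen R (inord 2)).
Definition elt_E : Cl := gen R ord0.

Definition q_decomposition (S S0 : Cl) (Sc : {set 'I_n.+1} -> Cl) : Prop :=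
  [/\ S0 \in qalg,
      forall M, multi_index M -> Sc M \in qalg
    & S = S0 + \sum_(M | multi_index M) Sc M * blade R M].

(* e^{mu_1 - 1} .. e^{mu_k - 1}: [ord_pred mu] is mu - 1 when mu > 0. *)
Definition shifted_blade (M : {set 'I_n.+1}) : Cl :=
  \prod_(mu in M) gen R (ord_pred mu).

End Hestenes.

From mathcomp Require Import all_classical all_reals all_analysis.
Import numFieldNormedType.Exports.
Local Open Scope ring_scope.

Section Calculus.
Variables (R : realType) (n : nat).
Local Notation Cl := (clifford R n).
Local Notation spacetime := 'cV[R]_n.+1.

Definition cl_differentiable (F : spacetime -> Cl) : Prop :=
  forall A x, differentiable (fun y => F y A) x.

Definition partial (mu : 'I_n.+1) (F : spacetime -> Cl) (x : spacetime) : Cl :=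
  [ffun A => 'D_(delta_mx mu 0) (fun y => F y A) x].

(* Hatted functions take the point P x of the new coordinates as argument. *)

Definition hat_partial (P : 'M[R]_n.+1) (mu : 'I_n.+1)
    (F : spacetime -> Cl) (y : spacetime) : Cl :=
  let Q := invmx P in
  \sum_nu Q nu mu *: partial nu (fun x => F (P *m x)) (Q *m y).

Definition hat_potential (P : 'M[R]_n.+1) (a : spacetime -> 'rV[R]_n.+1)
    (y : spacetime) : 'rV[R]_n.+1 :=
  let Q := invmx P in \row_mu \sum_nu Q nu mu * a (Q *m y) 0 nu.

Lemma hat_partialE (P : 'M[R]_n.+1) mu (F : spacetime -> Cl) :
  P \in unitmx -> cl_differentiable F ->
  hat_partial P mu F = partial mu F.
Proof.
move=> Pu dF; apply/funext=> y; apply/ffunP=> A.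
pose f z : R^o := F z A.
have DP v x : 'D_v (fun x => f (P *m x)) x = 'D_(P *m v) f (P *m x).
  rewrite /derive; set g1 := (X in lim (fmap X _)).
  set g2 := (X in _ = lim (fmap X _)); suff -> : g1 = g2 by [].
  by apply/funext=> h; rewrite /g1 /g2 /= mulmxDr -scalemxAr.
rewrite /hat_partial sum_ffunE ffunE.
have termE nu : (invmx P nu mu *: partial nu (fun x => F (P *m x))
    (invmx P *m y)) A
    = 'd f y (invmx P nu mu *: (P *m delta_mx nu 0)) :> R.
  rewrite linearZ -deriveE; last exact: dF.
  by rewrite !ffunE -[in RHS](mulKVmx Pu y) -DP.
rewrite (eq_bigr _ (fun nu _ => termE nu)).
rewrite -linear_sum -deriveE; last exact: dF.
congr ('D_ _ _ _); under eq_bigr => nu _ do rewrite scalemxAr.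
rewrite -mulmx_sumr (_ : \sum_nu _ = invmx P *m delta_mx mu 0) ?mulKVmx //.
by rewrite -colE; apply/colP=> k; rewrite summxE (bigD1 k) //= big1 => [|l nlk];
  rewrite !mxE ?eqxx ?mulr1 ?addr0 // eq_sym (negPf nlk) mulr0.
Qed.

End Calculus.

Section Equations.
Variables (R : realType) (d : nat).
Local Notation n := (2 * d - 1)%N.
Local Notation Cl := (clifford R n).
Local Notation spacetime := 'cV[R]_n.+1.
Local Notation I := (elt_I R d).
Local Notation E := (elt_E R d).

Definition dirac_hestenes (m : R) (a : spacetime -> 'rV[R]_n.+1)
    (Psi : spacetime -> Cl) : Prop :=
  let A mu x := partial mu Psi x + a x 0 mu *: (Psi x * I) in
  forall x,
    \sum_(mu | qindex mu) gen R mu * A mu x * E +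
    \sum_(mu | mid_index mu) A (ordS mu) x * gen R mu * E * I +
    m *: (Psi x * I) = 0.

(* Not literally [dirac_hestenes] with hats: I stands before, rather than
   after, the generator and E in the second sum. *)
Definition transformed_dirac_hestenes (m : R)
    (Dhat : 'I_n.+1 -> (spacetime -> Cl) -> spacetime -> Cl)
    (ahat : spacetime -> 'rV[R]_n.+1) (ehat : 'I_n.+1 -> Cl)
    (Psihat : spacetime -> Cl) : Prop :=
  let Ahat mu y := Dhat mu Psihat y + ahat y 0 mu *: (Psihat y * I) in
  forall y,
    \sum_(mu | qindex mu) ehat mu * Ahat mu y * E +
    \sum_(mu | mid_index mu) Ahat (ordS mu) y * I * ehat mu * E +
    m *: (Psihat y * I) = 0.

(* Unknowns of both equations: differentiable functions with values in the
   even part of [qalg]. *)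
Definition admissible (Psi : spacetime -> Cl) : Prop :=
  cl_differentiable Psi /\ forall x, Psi x \in qalg_even R d.

End Equations.

(* Main.v *)
(* Let t be the product of the commuting factors 1 + e^{mu-1} e^mu I over the
   generators e^mu outside Q'. Then e^mu t = e^{mu-1} I t, so right
   multiplication by t turns the right multiplications by e^{mu-1} I occurring in
   both equations and in Psihat into left multiplications by e^mu: the
   Dirac--Hestenes operator becomes (sum over all mu of e^mu A_mu E + m Psi I) t
   and Psihat t = S Psi E^b t, where b is the parity of S. As I and E commute
   with t, the usual covariance computation for the Dirac equation applies after
   multiplication by t. Finally X |-> X t is injective on Q': the automorphism
   e^mu |-> - e^mu fixes Q' and changes 1 + w into 1 - w, where
   w = e^{mu-1} e^mu I. The parity of Psihat also follows from
   Psihat t = S Psi E^b t. *)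

Require Import Defs.
From HB Require Import structures.
From mathcomp Require Import all_boot all_order all_algebra all_field.
From mathcomp Require Import ring zify.
Import GRing.Theory Num.Theory.
Local Open Scope ring_scope.

Set Implicit Arguments.
Unset Strict Implicit.
Unset Printing Implicit Defensive.

(** * Sign-change automorphisms of the Clifford algebra *)

Section Flip.
Variables (R : fieldType) (n : nat).
Local Notation Cl := (clifford R n).
Implicit Types (A C : {set 'I_n.+1}) (x y : Cl) (i j : 'I_n.+1).

Definition flip_sign C A : R := \prod_(i in A) (-1) ^+ (i \in C).

(** The algebra automorphism negating the generators with index in [C]. For [C = setT] it is the
    grade involution; for [C = [set mu]] it detects whether [e^mu] occurs. *)
Definition flip C x : Cl := [ffun A => flip_sign C A * x A].

Lemma flip_signD C A B :
  flip_sign C (symdiff A B) = flip_sign C A * flip_sign C B.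
Proof. by apply: prod_symdiff => i; rewrite -expr2 sqrr_sign. Qed.

Lemma flip_is_linear C : linear (flip C).
Proof.
move=> a x y; apply/ffunP=> A; rewrite !ffunE mulrDr; congr (_ + _).
by rewrite -[a *: x A]/(a * x A) -[RHS]/(a * _) mulrCA.
Qed.

HB.instance Definition _ C :=
  GRing.isLinear.Build R Cl Cl *:%R (flip C) (flip_is_linear C).

Lemma flip_basis_blade C A :
  flip C (basis_blade R A) = flip_sign C A *: basis_blade R A.
Proof.
by apply/ffunP=> B; rewrite !ffunE; case: eqP => [->|_]; rewrite ?mulr0 ?scaler0.
Qed.

(** [flip_sign C] is a character of the group of subsets under symmetric difference, and the
    Clifford product is a twisted convolution over that group. *)
Lemma flip_is_monoid_morphism C : monoid_morphism (flip C).
Proof.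
split=> [|x y].
  by rewrite -(basis_blade0 R n) flip_basis_blade /flip_sign big_set0 scale1r.
apply/ffunP=> A; rewrite !ffunE mulr_sumr; apply: eq_bigr => B _; rewrite !ffunE.
have -> : flip_sign C A = flip_sign C B * flip_sign C (symdiff B A).
  by rewrite -flip_signD symdiffK.
move: (blade_sign _ _ _) (flip_sign C B) (flip_sign C _) => s f g; ring.
Qed.

HB.instance Definition _ C :=
  GRing.isMonoidMorphism.Build Cl Cl (flip C) (flip_is_monoid_morphism C).

Lemma flip_gen C i : flip C (gen R i) = (-1) ^+ (i \in C) *: gen R i.
Proof. by rewrite flip_basis_blade /flip_sign big_set1. Qed.

Lemma flip_gen_notin C i : i \notin C -> flip C (gen R i) = gen R i.
Proof. by rewrite flip_gen => /negPf->; rewrite scale1r. Qed.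

Lemma flip_gen_in C i : i \in C -> flip C (gen R i) = - gen R i.
Proof. by rewrite flip_gen => ->; rewrite scaleN1r. Qed.

Lemma flip_signT A : flip_sign setT A = (-1) ^+ #|A|.
Proof. by rewrite -prodr_const; apply: eq_bigr => i _; rewrite inE. Qed.

Lemma gen_anticomm_neq i j : i != j -> gen R i * gen R j = - (gen R j * gen R i).
Proof.
move=> ij; apply/eqP; rewrite -addr_eq0 gen_anticomm mxE (negPf ij).
by rewrite mulr0 scale0r.
Qed.

Lemma flip_flip C D x : flip C (flip D x) = flip D (flip C x).
Proof. by apply/ffunP=> A; rewrite !ffunE mulrCA. Qed.

(** The fixed space of an automorphism contains 1 and is stable under left multiplication by the
    fixed generators, so it contains the algebra they generate. *)
Lemma flip_fixed_agenv C (X : seq Cl) x :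
  (forall y, y \in X -> flip C y = y) -> x \in agenv <<X>>%VS -> flip C x = x.
Proof.
move=> fX; have fixE y : (y \in fixedSpace (linfun (flip C))) = (flip C y == y).
  by rewrite (sameP fixedSpaceP eqP) lfunE.
suff /subvP sub : (agenv <<X>> <= fixedSpace (linfun (flip C)))%VS.
  by move/sub; rewrite fixE => /eqP.
apply: agenv_sub_modl; first by rewrite -memvE fixE rmorph1.
apply/prodvP=> u v Uu; rewrite !fixE => /eqP fv.
have /subvP/(_ _ Uu) : (<<X>> <= fixedSpace (linfun (flip C)))%VS.
  by apply/span_subvP=> y /fX fy; rewrite fixE fy.
by rewrite fixE => /eqP fu; rewrite rmorphM /= fu fv.
Qed.

Lemma flipT_parity (b : bool) x :
  x \in parity_part R n b -> flip setT x = (-1) ^+ b *: x.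
Proof.
pose V := lker (linfun (flip setT) - (-1) ^+ b *: \1)%VF.
have VE y : (y \in V) = (flip setT y == (-1) ^+ b *: y).
  by rewrite memv_ker add_lfunE opp_lfunE scale_lfunE id_lfunE lfunE subr_eq0.
suff /subvP sub : (parity_part R n b <= V)%VS by move/sub; rewrite VE => /eqP.
apply/span_subvP => y /mapP[A]; rewrite mem_enum inE => /eqP oA ->.
by rewrite VE bladeE flip_basis_blade flip_signT -oA signr_odd.
Qed.

End Flip.

(** * Elements fixed by sign changes, in characteristic 0 *)

Section FlipFixed.
Variables (R : numFieldType) (n : nat).
Local Notation Cl := (clifford R n).
Implicit Types (A C : {set 'I_n.+1}) (x y : Cl) (i j : 'I_n.+1).

(** The coefficient equals its own opposite, and 2 is invertible. *)
Lemma flip_fixed_coef C x A : flip C x = x -> flip_sign R C A = -1 -> x A = 0.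
Proof.
move=> /ffunP/(_ A); rewrite ffunE => + e; rewrite {}e mulN1r => /esym/eqP.
by rewrite -addr_eq0 -mulr2n mulrn_eq0 /= => /eqP.
Qed.

Lemma even_part_flip x : flip setT x = x -> x \in even_part R n.
Proof.
move=> fx; rewrite [x]sum_basis_blade; apply: memv_suml => A _.
case: (boolP (odd #|A|)) => oA.
  by rewrite (flip_fixed_coef fx) ?scale0r ?mem0v // flip_signT -signr_odd oA.
apply/memvZ/memv_span; rewrite -bladeE; apply: map_f.
by rewrite mem_enum inE (negPf oA).
Qed.

(** Only blades free of [e^i] occur in [x], and moving [e^i] across such a blade with [k] factors
    costs [(-1)^k]. *)
Lemma gen_flip i x : flip [set i] x = x -> gen R i * x = flip setT x * gen R i.
Proof.
move=> fi; rewrite [x]sum_basis_blade (raddf_sum (flip setT)) mulr_sumr mulr_suml.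
apply: eq_bigr => A _; rewrite /= linearZ /= flip_basis_blade flip_signT.
case: (boolP (i \in A)) => iA.
  rewrite (flip_fixed_coef fi) ?scale0r ?mulr0 ?mul0r //.
  rewrite /flip_sign (bigD1 i) //= inE eqxx big1 ?mulr1 // => j /andP[_ ji].
  by rewrite inE (negPf ji).
rewrite -scalerAr -scalerAl; congr (_ *: _).
rewrite /gen -scalerAl !basis_bladeM symdiffC blade_sign_swap cards1 muln1 scalerA.
by rewrite disjoint_setI0 ?cards0 ?addn0 // disjoint_sym disjoints1.
Qed.

Lemma gen_comm i x :
  flip [set i] x = x -> flip setT x = x -> GRing.comm x (gen R i).
Proof. by move=> /gen_flip + fT; rewrite fT => /esym. Qed.

End FlipFixed.

(** * The shift between indices outside [Q'] and their predecessors *)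

Section Index.
Variable d : nat.
Hypothesis d_ge2 : (2 <= d)%N.
Implicit Types mu nu : 'I_(2 * d - 1).+1.

Lemma val_ord_pred mu : ~~ qindex mu -> val (ord_pred mu) = mu.-1.
Proof.
rewrite /qindex negb_or -ltnNge => /andP[mu3 _] /=.
have mu_lt := ltn_ord mu.
have -> : ((mu + (2 * d - 1).+1).-1 = mu.-1 + (2 * d - 1).+1)%N by lia.
by rewrite modnDr modn_small //; lia.
Qed.

Lemma nonq_gt3 mu : ~~ qindex mu -> (3 < mu)%N.
Proof. by rewrite /qindex negb_or -ltnNge => /andP[]. Qed.

Lemma ord_pred_ge3 mu : ~~ qindex mu -> (3 <= ord_pred mu)%N.
Proof. by move=> nq; have := nonq_gt3 nq; rewrite val_ord_pred //; lia. Qed.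

Lemma qindex_ord_pred mu : ~~ qindex mu -> qindex (ord_pred mu).
Proof.
move=> nq; have mu3 := nonq_gt3 nq; rewrite /qindex val_ord_pred //.
by move: nq; rewrite /qindex negb_or => /andP[_]; lia.
Qed.

(** The successor map sends 3, 5, .., 2d-3 onto the even indices 4, 6, .., 2d-2, which are those
    outside [Q']. *)
Lemma mid_index_ordS mu : mid_index mu = ~~ qindex (ordS mu).
Proof.
rewrite /mid_index /qindex /=; move: (nat_of_ord mu) (ltn_ord mu) => k.
rewrite ltnS leq_eqVlt => /orP[/eqP->|k_lt].
  (* [ordS] is cyclic: the last index 2d-1 goes to 0, which belongs to [Q']. *)
  by rewrite modnn /=; lia.
by rewrite modn_small //; lia.
Qed.

Lemma sum_mid_index (V : zmodType)
    (F : 'I_(2 * d - 1).+1 -> 'I_(2 * d - 1).+1 -> V) :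
  \sum_(mu | mid_index mu) F mu (ordS mu) =
  \sum_(mu | ~~ qindex mu) F (ord_pred mu) mu.
Proof.
rewrite [RHS](reindex_inj (can_inj (@ordSK _))) /=.
by apply: eq_big => mu; rewrite ?mid_index_ordS // ordSK.
Qed.

End Index.

(** * The element [I], the product [t], and cancellation of [t] on [Q'] *)

Section Projector.
Variables (R : numFieldType) (d : nat).
Hypothesis d_ge2 : (2 <= d)%N.
Local Notation n := (2 * d - 1)%N.
Local Notation Cl := (clifford R n).
Local Notation I := (elt_I R d).
Local Notation E := (elt_E R d).
Implicit Types (x y : Cl) (i j mu nu : 'I_n.+1) (s : seq 'I_n.+1).

Lemma comm_anti x y z :
  y * x = - (x * y) -> z * x = - (x * z) -> GRing.comm x (y * z).
Proof.
by move=> yx zx; rewrite /GRing.comm -mulrA zx mulrN !mulrA yx mulNr opprK.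
Qed.

Lemma ge3_neq i : (3 <= i)%N -> (i != inord 1) && (i != inord 2).
Proof.
by move=> i3; apply/andP; split; apply: contraTneq i3 => ->; rewrite inordK; lia.
Qed.

Lemma inord12_neq : [/\ inord 1 != ord0 :> 'I_n.+1, inord 2 != ord0 :> 'I_n.+1
  & inord 1 != inord 2 :> 'I_n.+1].
Proof. by rewrite -!val_eqE /= !inordK //; lia. Qed.


Lemma double_inj x y : x + x = y + y -> x = y.
Proof.
by rewrite -!mulr2n -!scaler_nat => /scalerI; apply; rewrite pnatr_eq0.
Qed.

Lemma gen_sq i : i != ord0 -> gen R i * gen R i = -1.
Proof.
move=> i0; apply: double_inj; rewrite gen_anticomm mxE eqxx /minkowski.
by rewrite (negPf i0) mulrN1 scaleNr scaler_nat mulr2n opprD.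
Qed.

Lemma I_comm_gen i : i != inord 1 -> i != inord 2 -> GRing.comm I (gen R i).
Proof.
move=> i1 i2; apply/commr_sym/commrN/comm_anti;
  by apply/gen_anticomm_neq; rewrite eq_sym.
Qed.

Lemma I_sq : I * I = -1.
Proof.
have [n10 n20 n12] := inord12_neq; rewrite /elt_I mulrNN mulrA.
rewrite -[_ * _ * gen _ (inord 1)]mulrA [gen R (inord 2) * _]gen_anticomm_neq.
  by rewrite mulrN mulrA gen_sq // mulN1r opprK gen_sq.
by rewrite eq_sym.
Qed.

Lemma I_comm_ge3 i : (3 <= i)%N -> GRing.comm I (gen R i).
Proof. by case/ge3_neq/andP=> i1 i2; apply: I_comm_gen. Qed.

Lemma I_comm_E : GRing.comm I E.
Proof. by have [n10 n20 _] := inord12_neq; apply: I_comm_gen; rewrite eq_sym. Qed.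

(** For [mu] outside [Q'], the two generators and [I] each square to -1; the generators anticommute
    with each other and commute with [I]. *)
Definition pair_involution mu : Cl := gen R (ord_pred mu) * gen R mu * I.

(* The factors are twice idempotents, as [pair_involution mu] squares to 1. *)
Definition hproj_seq s : Cl := \prod_(mu <- s) (1 + pair_involution mu).

Lemma pair_involution_comm_gen mu i : i != inord 1 -> i != inord 2 -> i != mu ->
  i != ord_pred mu -> GRing.comm (gen R i) (pair_involution mu).
Proof.
move=> i1 i2 im ip; apply: commrM; last exact/commr_sym/I_comm_gen.
by apply: comm_anti; apply: gen_anticomm_neq; rewrite eq_sym.
Qed.

Lemma pair_involution_comm_I mu : ~~ qindex mu -> GRing.comm I (pair_involution mu).
Proof.
move=> nq; have mu3 := nonq_gt3 nq.
apply: commrM; last exact: commr_refl.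
by apply: commrM; apply: I_comm_ge3; rewrite ?ord_pred_ge3 // ltnW.
Qed.

Lemma comm1D x y : GRing.comm x y -> GRing.comm x (1 + y).
Proof. by move=> xy; apply: commrD => //; apply: commr1. Qed.

Lemma comm_hproj_seq x s :
  {in s, forall mu, GRing.comm x (pair_involution mu)} ->
  GRing.comm x (hproj_seq s).
Proof.
move=> xs; rewrite /hproj_seq big_seq; apply: big_ind => [|y z|mu /xs].
- exact: commr1.
- exact: commrM.
- exact: comm1D.
Qed.

(** With [w = pair_involution mu] one has [e^mu w = e^{mu-1} I] and [e^{mu-1} I w = e^mu], so
    [e^mu (1 + w) = e^{mu-1} I (1 + w)]. The factors for other indices commute with [e^mu],
    [e^{mu-1}] and [I]. *)
Lemma gen_hproj_seq mu s : all (predC (@qindex d)) s -> mu \in s ->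
  gen R mu * hproj_seq s = gen R (ord_pred mu) * I * hproj_seq s.
Proof.
rewrite /hproj_seq; elim: s => //= nu s IHs /andP[nq_nu nq_s].
rewrite in_cons => mus; rewrite big_cons.
have nq_mu : ~~ qindex mu.
  by case/orP: mus => [/eqP->//|/(allP nq_s)].
have [-> {mus IHs nq_mu}|ne] := eqVneq mu nu; last first.
  move: mus; rewrite (negPf ne) /= => /IHs-/(_ nq_s) IH.
  have mu3 := nonq_gt3 nq_mu; have p3 := ord_pred_ge3 d_ge2 nq_mu.
  have /andP[mu1 mu2] := ge3_neq (ltnW mu3); have /andP[p1 p2] := ge3_neq p3.
  have cg : GRing.comm (gen R mu) (1 + pair_involution nu).
    apply/comm1D/pair_involution_comm_gen => //.
    by apply: contraNneq nq_mu => ->; apply: qindex_ord_pred.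
  have cp : GRing.comm (gen R (ord_pred mu)) (1 + pair_involution nu).
    apply/comm1D/pair_involution_comm_gen => //.
      by apply: contraNneq nq_nu => <-; apply: qindex_ord_pred.
    by rewrite (inj_eq (@ord_pred_inj _)).
  have cI : GRing.comm I (1 + pair_involution nu) by apply/comm1D/pair_involution_comm_I.
  rewrite mulrA cg -mulrA IH !mulrA; congr (_ * _).
  by rewrite -!mulrA cI !mulrA cp.
rewrite !mulrA; congr (_ * _); rewrite /pair_involution !mulrDr !mulr1.
have p3 := ord_pred_ge3 d_ge2 nq_nu; have nu3 := nonq_gt3 nq_nu.
have np : nu != ord_pred nu.
  by apply: contraNneq (nq_nu) => {1}->; apply: qindex_ord_pred.
have -> : gen R nu * (gen R (ord_pred nu) * gen R nu * I) = gen R (ord_pred nu) * I.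
  rewrite !mulrA gen_anticomm_neq // mulNr -[_ * _ * gen R nu]mulrA gen_sq ?mulrN1 ?opprK //.
  by apply: contraTneq nu3 => ->.
(* The two summands change places; [e^{nu-1} I w = e^nu] remains. *)
rewrite addrC; congr (_ + _).
have Ip : I * gen R (ord_pred nu) = gen R (ord_pred nu) * I by apply: I_comm_ge3.
have In : I * gen R nu = gen R nu * I by apply/I_comm_ge3/ltnW.
rewrite -!mulrA (mulrA I) Ip -(mulrA _ I).
rewrite (mulrA I) In -(mulrA _ I) I_sq mulrN1 !mulrN mulrA gen_sq.
  by rewrite mulN1r opprK.
by apply: contraTneq p3 => ->.
Qed.

(** Absence of the generators outside [Q'], expressed through linear automorphisms: this form passes
    to products and, by linearity, to partial derivatives. *)
Definition qfixed x := forall mu, ~~ qindex mu -> flip [set mu] x = x.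

Lemma qfixed_gen i : qindex i -> qfixed (gen R i).
Proof.
by move=> qi mu nq; apply: flip_gen_notin; rewrite inE; apply: contraNneq nq => <-.
Qed.

Lemma qfixedM x y : qfixed x -> qfixed y -> qfixed (x * y).
Proof. by move=> fx fy mu nq; rewrite rmorphM /= fx ?fy. Qed.

Lemma qfixedD x y : qfixed x -> qfixed y -> qfixed (x + y).
Proof. by move=> fx fy mu nq; rewrite raddfD /= fx ?fy. Qed.

Lemma qfixedZ (c : R) x : qfixed x -> qfixed (c *: x).
Proof. by move=> fx mu nq; rewrite linearZ /= fx. Qed.

Lemma qfixed_sum (J : finType) (p : pred J) (F : J -> Cl) :
  (forall k, p k -> qfixed (F k)) -> qfixed (\sum_(k | p k) F k).
Proof. by move=> fF mu nq; rewrite raddf_sum; apply: eq_bigr => k /fF/(_ _ nq). Qed.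

Lemma qfixed_qalg x : x \in qalg R d -> qfixed x.
Proof.
move=> qx mu nq; apply: flip_fixed_agenv qx => y /mapP[i].
by rewrite mem_enum => qi ->; apply: qfixed_gen.
Qed.

Lemma qalg_gen i : qindex i -> gen R i \in qalg R d.
Proof.
move=> qi; apply: (subvP (sub_agenv _)); apply: memv_span.
by apply: map_f; rewrite mem_enum.
Qed.

Lemma qalg1 : 1 \in qalg R d.
Proof. by rewrite memvE sub1_agenv. Qed.

Lemma qalgM x y : x \in qalg R d -> y \in qalg R d -> x * y \in qalg R d.
Proof. exact: (@memvM _ _ (agenv_aspace _)). Qed.

Lemma qalg_I : I \in qalg R d.
Proof.
by rewrite memvN; apply: qalgM; apply: qalg_gen; rewrite /qindex ?inordK //; lia.
Qed.

Lemma qalg_E : E \in qalg R d.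
Proof. exact: qalg_gen. Qed.

(** Only the flips at indices of [s] are assumed to fix [x]: after the first factor is absorbed,
    [x (1 + w)] is still fixed by the flips for the rest of the list, so induction gives
    [x (1 + w) = 0]. *)
Lemma hproj_seq_inj s x : uniq s -> all (predC (@qindex d)) s ->
  {in s, forall mu, flip [set mu] x = x} -> x * hproj_seq s = 0 -> x = 0.
Proof.
elim: s x => [|nu s IHs] x /=; first by rewrite /hproj_seq big_nil mulr1.
move=> /andP[nu_s us] /andP[nq_nu nq_s] fx.
have fw mu : ~~ qindex mu -> flip [set mu] (pair_involution nu) =
    (-1) ^+ (mu == nu) *: pair_involution nu.
  move=> nq_mu; rewrite !rmorphM /= (qfixed_qalg qalg_I) //.
  rewrite (qfixed_gen (qindex_ord_pred d_ge2 nq_nu)) // flip_gen inE eq_sym.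
  by rewrite -scalerAr -scalerAl.
rewrite /hproj_seq big_cons mulrA => /IHs; rewrite us nq_s => /(_ isT isT) xw.
have {}xw : x * (1 + pair_involution nu) = 0.
  apply: xw => mu mus; have nq_mu := allP nq_s _ mus.
  rewrite rmorphM rmorphD rmorph1 /= fw // fx ?inE ?mus ?orbT //.
  by rewrite (_ : mu == nu = false) ?scale1r //; apply: contraNF nu_s => /eqP<-.
have := congr1 (flip [set nu]) xw.
rewrite rmorphM rmorphD rmorph1 /= fw // fx ?mem_head // eqxx raddf0.
move: xw; rewrite !mulrDr mulr1 scaleN1r mulrN => xwD xwB.
apply: double_inj; rewrite addr0 -[RHS](addr0 0) -{2}xwD -xwB.
by rewrite addrACA addNr addr0.
Qed.
Definition hproj : Cl := hproj_seq (enum (predC (@qindex d))).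

Lemma all_nonq : all (predC (@qindex d)) (enum (predC (@qindex d))).
Proof. by apply/allP=> mu; rewrite mem_enum. Qed.

Lemma hproj_inj x : qfixed x -> x * hproj = 0 -> x = 0.
Proof.
move=> fx; apply: hproj_seq_inj => //; first exact: enum_uniq.
  exact: all_nonq.
by move=> mu; rewrite mem_enum => /fx.
Qed.

Lemma gen_hproj mu :
  ~~ qindex mu -> gen R mu * hproj = gen R (ord_pred mu) * I * hproj.
Proof.
by move=> nq; apply: gen_hproj_seq => //; [exact: all_nonq | rewrite mem_enum].
Qed.

Lemma I_comm_hproj : GRing.comm I hproj.
Proof.
apply: comm_hproj_seq => mu; rewrite mem_enum => nq.
exact: pair_involution_comm_I.
Qed.

Lemma E_comm_hproj : GRing.comm E hproj.
Proof.
apply: comm_hproj_seq => mu; rewrite mem_enum => nq.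
have [n10 n20 _] := inord12_neq.
apply: pair_involution_comm_gen; rewrite 1?eq_sym //.
  by apply: contraTneq (nonq_gt3 nq) => ->.
by apply: contraTneq (ord_pred_ge3 d_ge2 nq) => ->.
Qed.

Lemma flipT_I : flip setT I = I.
Proof. by rewrite rmorphN rmorphM /= !flip_gen_in ?inE // mulrNN. Qed.

Lemma flipT_hproj : flip setT hproj = hproj.
Proof.
rewrite rmorph_prod; apply: eq_bigr => mu _.
rewrite rmorphD rmorph1 !rmorphM /= flipT_I.
by rewrite !flip_gen_in ?inE // mulrNN.
Qed.

(** By induction, [e^{mu-1} B' I^{k+1} t = e^{mu-1} B I t], where [B] and [B'] are the unshifted and
    shifted tails. Moving [e^{mu-1}] right across [B] and then [e^mu] back left produces the same
    sign twice, with [e^{mu-1} I t = e^mu t] used in between. *)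
Lemma shifted_prod_hproj s : uniq s -> all (predC (@qindex d)) s ->
  (\prod_(mu <- s) gen R (ord_pred mu)) * I ^+ size s * hproj =
  (\prod_(mu <- s) gen R mu) * hproj.
Proof.
elim: s => [|mu s IHs] /=; first by rewrite !big_nil expr0 mulr1.
case/andP=> mu_s us /andP[nq_mu nq_s]; rewrite !big_cons.
set B := \prod_(j <- s) gen R j in IHs *.
set B' := \prod_(j <- s) gen R (ord_pred j) in IHs *.
have IB' : GRing.comm I B'.
  rewrite /B' big_seq; apply: big_ind => [|y z|j /(allP nq_s) nq_j].
  - exact: commr1.
  - exact: commrM.
  - by apply: I_comm_ge3; rewrite ?ord_pred_ge3.
have fB i : i \notin s -> gen R i * B = flip setT B * gen R i.
  move=> i_s; apply: gen_flip; rewrite rmorph_prod /B !big_seq.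
  apply: eq_bigr => j js; apply: flip_gen_notin; rewrite inE.
  by apply: contraNneq i_s => <-.
have IB : GRing.comm I B.
  rewrite /B big_seq; apply: big_ind => [|y z|j /(allP nq_s) nq_j].
  - exact: commr1.
  - exact: commrM.
  - by apply: I_comm_ge3; rewrite // ltnW // nonq_gt3.
have p_s : ord_pred mu \notin s.
  apply/negP=> /(allP nq_s); rewrite /= (qindex_ord_pred d_ge2) //.
rewrite exprS -!mulrA (mulrA B') -IB' -!mulrA (mulrA B') IHs //.
rewrite (mulrA I) IB -mulrA (mulrA _ B) fB // -mulrA (mulrA (gen _ _)).
by rewrite -gen_hproj // !mulrA -fB.
Qed.

Lemma shifted_blade_hproj M : multi_index M ->
  shifted_blade R M * I ^+ #|M| * hproj = blade R M * hproj.
Proof.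
case/andP=> _ /forall_inP nqM.
have [e big_e [Ue mem_e] [_ size_e]] := big_enumP (mem M).
rewrite /shifted_blade /blade -!big_e -size_e shifted_prod_hproj //.
by apply/allP=> mu; rewrite mem_e; apply: nqM.
Qed.

Definition qeven x := qfixed x /\ flip setT x = x.

Lemma qeven_comm_blade x M : qeven x -> multi_index M -> GRing.comm x (blade R M).
Proof.
move=> [fx fTx] /andP[_ /forall_inP nqM].
apply: big_ind => [|y z|mu /nqM nq]; [exact: commr1|exact: commrM|].
by apply: gen_comm => //; apply: fx.
Qed.

Lemma qevenD x y : qeven x -> qeven y -> qeven (x + y).
Proof. by move=> [fx ex] [fy ey]; split; [exact: qfixedD | rewrite raddfD /= ex ey]. Qed.

Lemma qevenZ (k : R) x : qeven x -> qeven (k *: x).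
Proof. by move=> [fx ex]; split; [exact: qfixedZ | rewrite linearZ /= ex]. Qed.

Lemma qevenM x y : qeven x -> qeven y -> qeven (x * y).
Proof. by move=> [fx ex] [fy ey]; split; [exact: qfixedM | rewrite rmorphM /= ex ey]. Qed.

Lemma qeven_I : qeven I.
Proof. by split; [exact/qfixed_qalg/qalg_I | exact: flipT_I]. Qed.

Lemma qeven_qalg_even x : x \in qalg_even R d -> qeven x.
Proof.
by case/memv_capP=> /qfixed_qalg qx /flipT_parity; rewrite scale1r.
Qed.

(** The left side of the Dirac--Hestenes equation at one point, with arbitrary values [X mu] for the
    covariant derivatives. *)
Definition dirac_operator (m : R) (X : 'I_n.+1 -> Cl) y : Cl :=
  \sum_(mu | qindex mu) gen R mu * X mu * E +
  \sum_(mu | mid_index mu) X (ordS mu) * gen R mu * E * I + m *: (y * I).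

(** In front of [t], [e^{mu-1} I] becomes [e^mu] for [mu] outside [Q'], and this generator commutes
    with the even element [X mu] of [Q']. The second sum thus supplies the terms missing from the
    first. *)
Lemma dirac_operator_hproj (m : R) (X : 'I_n.+1 -> Cl) y :
  (forall mu, qeven (X mu)) ->
  dirac_operator m X y * hproj =
  (\sum_mu gen R mu * X mu * E + m *: (y * I)) * hproj.
Proof.
move=> eX; rewrite /dirac_operator !mulrDl; congr (_ + _).
rewrite [in RHS](bigID (@qindex d)) /= mulrDl; congr (_ + _).
rewrite (sum_mid_index d_ge2 (fun mu nu => X nu * gen R mu * E * I)) !mulr_suml.
apply: eq_bigr => mu nq; have [fX TX] := eX mu.
rewrite -(gen_comm (fX mu nq) TX) -!mulrA (mulrA E) -I_comm_E //.
rewrite -!mulrA E_comm_hproj !mulrA.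
by congr (_ * _); rewrite -!mulrA gen_hproj // !mulrA.
Qed.

(** The two forms differ only in the place of [I], which commutes with [E] and with [e^mu] for
    [mu >= 3]. *)
Lemma dirac_operator_transformed (m : R) (X : 'I_n.+1 -> Cl) y :
  \sum_(mu | qindex mu) gen R mu * X mu * E +
  \sum_(mu | mid_index mu) X (ordS mu) * I * gen R mu * E + m *: (y * I) =
  dirac_operator m X y.
Proof.
congr (_ + _ + _); apply: eq_bigr => mu /and3P[mu3 _ _].
rewrite -!mulrA -I_comm_E (mulrA (gen R mu) I).
by rewrite -(I_comm_ge3 mu3) -!mulrA.
Qed.

(** * The map from [Psi] to its transform, and covariance at a point *)

Section SpinorMap.
Variables (S S0 : Cl) (Sc : {set 'I_n.+1} -> Cl) (b : bool).
Hypothesis S_dec : q_decomposition S S0 Sc.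
Local Notation c := (E ^+ b).

(** Both cases at once: [b] is the parity of [S], and the factor [E ^+ b] is 1 for Spin and [E]
    otherwise. *)
Definition spinor_map x : Cl :=
  (S0 * x + \sum_(M | multi_index M) Sc M * x * shifted_blade R M * I ^+ #|M|) * c.

Lemma spinor_map_is_linear : linear spinor_map.
Proof.
move=> k x y; rewrite /spinor_map scalerAl -mulrDl; congr (_ * _).
rewrite scalerDr scaler_sumr addrACA -big_split /= mulrDr scalerAr.
congr (_ + _); apply: eq_bigr => M _.
by rewrite mulrDr !mulrDl -scalerAr -!scalerAl.
Qed.

HB.instance Definition _ :=
  GRing.isLinear.Build R Cl Cl *:%R spinor_map spinor_map_is_linear.

Lemma E_pow_comm_hproj : c * hproj = hproj * c.
Proof. exact/commr_sym/commrX/commr_sym/E_comm_hproj. Qed.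

Lemma E_pow_comm_I : c * I = I * c.
Proof. exact/commr_sym/commrX/I_comm_E. Qed.

(** In front of [t] each shifted blade with its power of [I] becomes the true blade, which commutes
    with [x]; the decomposition of [S] then reassembles to the left of [x]. *)
Lemma spinor_map_hproj x : qeven x -> spinor_map x * hproj = S * x * c * hproj.
Proof.
move=> ex; rewrite -!mulrA E_pow_comm_hproj !mulrA; congr (_ * _).
have [_ _ ->] := S_dec; rewrite !mulrDl !mulr_suml; congr (_ + _).
apply: eq_bigr => M mM; rewrite -!mulrA; congr (_ * _).
have := shifted_blade_hproj mM; rewrite -!mulrA => ->.
by rewrite !mulrA (qeven_comm_blade ex mM).
Qed.

Lemma qalg_E_pow : c \in qalg R d.
Proof. by case: b; [exact: qalg_E | exact: qalg1]. Qed.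

Lemma qalg_I_pow k : I ^+ k \in qalg R d.
Proof. by elim: k => [|k IHk]; [exact: qalg1 | rewrite exprS qalgM ?qalg_I]. Qed.

Lemma qalg_shifted_blade M : multi_index M -> shifted_blade R M \in qalg R d.
Proof.
case/andP=> _ /forall_inP nqM.
apply: (big_ind (fun y => y \in qalg R d)) => [|y z|mu /nqM nq];
  [exact: qalg1|exact: qalgM|].
exact/qalg_gen/qindex_ord_pred.
Qed.

Lemma spinor_map_qalg x : x \in qalg R d -> spinor_map x \in qalg R d.
Proof.
move=> qx; have [qS0 qSc _] := S_dec; apply: qalgM; last exact: qalg_E_pow.
apply: memvD; first exact: qalgM.
apply: memv_suml => M mM; apply: qalgM.
  by rewrite !qalgM ?qSc ?qalg_shifted_blade.
exact: qalg_I_pow.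
Qed.

Lemma spinor_map_qfixed x : qfixed x -> qfixed (spinor_map x).
Proof.
have [qS0 qSc _] := S_dec; move=> fx.
apply: qfixedM; last exact/qfixed_qalg/qalg_E_pow.
apply: qfixedD; first by apply: qfixedM => //; apply: qfixed_qalg.
apply: qfixed_sum => M mM.
do 3?apply: qfixedM => //; apply: qfixed_qalg; [exact: qSc|exact: qalg_shifted_blade|].
exact: qalg_I_pow.
Qed.

(** Under the grade involution [S] and [E ^+ b] each contribute [(-1)^b], so [S x E^b t] is
    invariant; cancelling [t] gives evenness of the image. *)
Lemma spinor_map_qeven x : S \in parity_part R n b -> qeven x -> qeven (spinor_map x).
Proof.
move=> pS ex; have [fx Tx] := ex.
have fLx : qfixed (spinor_map x) by exact: spinor_map_qfixed.
split=> //; apply/eqP; rewrite -subr_eq0; apply/eqP/hproj_inj.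
  by move=> mu nq; rewrite raddfB /= flip_flip (fLx _ nq).
rewrite mulrBl -{1}flipT_hproj -rmorphM spinor_map_hproj // !rmorphM /= flipT_hproj.
rewrite Tx rmorphXn /= (flipT_parity pS) flip_gen_in ?inE //.
case: b; rewrite /= ?scaleN1r ?scale1r ?expr1 ?expr0 ?mulr1 ?subrr //.
by rewrite !mulNr mulrN mulNr opprK subrr.
Qed.

Lemma spinor_map_even x : S \in parity_part R n b ->
  x \in qalg_even R d -> spinor_map x \in qalg_even R d.
Proof.
move=> pS qx; have [_ TLx] := spinor_map_qeven pS (qeven_qalg_even qx).
rewrite memv_cap spinor_map_qalg ?even_part_flip //.
by case/memv_capP: qx.
Qed.

Lemma dirac_operator_spinor_map (P : 'M[R]_n.+1) (m : R) (D : 'I_n.+1 -> Cl)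
    (a : 'I_n.+1 -> R) x :
  P \in unitmx -> S \is a GRing.unit ->
  (forall mu, S^-1 * gen R mu * S = \sum_nu P mu nu *: gen R nu) ->
  (forall mu, qeven (D mu)) -> qeven x ->
  (forall mu, qeven (spinor_map (D mu))) -> qeven (spinor_map x) ->
  dirac_operator m (fun mu => D mu + a mu *: (x * I)) x = 0 ->
  dirac_operator m (fun mu => \sum_nu invmx P nu mu *: spinor_map (D nu) +
      (\sum_nu invmx P nu mu * a nu) *: (spinor_map x * I)) (spinor_map x) = 0.
Proof.
move=> Pu Su SP eD ex eLD eLx; set A := fun mu => D mu + _.
set Ahat := fun mu => \sum_nu _ + _ => eq0.
have eA mu : qeven (A mu).
  by apply: qevenD => //; apply/qevenZ/qevenM => //; apply: qeven_I.
have eAhat mu : qeven (Ahat mu).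
  apply: qevenD; last by apply/qevenZ/qevenM => //; apply: qeven_I.
  split.
    by apply: qfixed_sum => nu _; apply: qfixedZ; case: (eLD nu).
  rewrite raddf_sum; apply: eq_bigr => nu _; rewrite /= linearZ /=.
  by case: (eLD nu) => _ ->.
have qE : qfixed E by apply: qfixed_gen.
have qI : qfixed I by case: qeven_I.
(* The transformed expression lies in the domain where [t] cancels, so it suffices to prove the
   equation after multiplication by [t]. *)
apply: hproj_inj.
  apply: qfixedD; last by apply/qfixedZ/qfixedM => //; case: eLx.
  apply: qfixedD; apply: qfixed_sum => mu mmu.
    apply: qfixedM => //; apply: qfixedM; first exact: qfixed_gen.
    by case: (eAhat mu).
  do 3?apply: qfixedM => //; first by case: (eAhat (ordS mu)).
  by apply: qfixed_gen; case/and3P: mmu => _ _ odd_mu; rewrite /qindex odd_mu orbT.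
have E_proj := E_comm_hproj; have I_proj := I_comm_hproj.
have c_proj := E_pow_comm_hproj; have c_I := E_pow_comm_I.
have c_E : c * E = E * c by rewrite -exprS -exprSr.
(* In front of [t], the transformed covariant derivatives are the [Q]-combinations of
   [S A_nu E^b]. *)
have AhatE mu : Ahat mu * hproj = \sum_nu invmx P nu mu *: (S * A nu * c * hproj).
  rewrite mulrDl -scalerAl -mulrA I_proj mulrA spinor_map_hproj // mulr_suml.
  rewrite scaler_suml -big_split /=; apply: eq_bigr => nu _.
  rewrite -scalerAl spinor_map_hproj // -scalerA -scalerDr; congr (_ *: _).
  rewrite /A mulrDr !mulrDl; congr (_ + _).
  rewrite -scalerAr -!scalerAl; congr (_ *: _).
  by rewrite -!mulrA -I_proj !mulrA; congr (_ * _); rewrite -!mulrA c_I.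
(* Contracting [e^mu S = p^mu_l S e^l] with [q^nu_mu] leaves [S e^nu], since [Q P = 1]. *)
have genS nu : \sum_mu invmx P nu mu *: (gen R mu * S) = S * gen R nu.
  have SPmu mu : gen R mu * S = S * \sum_l P mu l *: gen R l.
    by rewrite -SP !mulrA divrr // mul1r.
  under eq_bigr => mu _ do rewrite SPmu scalerAr.
  rewrite -mulr_sumr; congr (_ * _).
  under eq_bigr => mu _ do rewrite scaler_sumr.
  rewrite exchange_big /= (bigD1 nu) //= [X in _ + X]big1 => [|l l_nu].
    under eq_bigr => mu _ do rewrite scalerA.
    rewrite addr0 -scaler_suml; have /matrixP/(_ nu nu) := mulVmx Pu.
    by rewrite !mxE eqxx => ->; rewrite scale1r.
  under eq_bigr => mu _ do rewrite scalerA.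
  rewrite -scaler_suml; have /matrixP/(_ nu l) := mulVmx Pu.
  by rewrite !mxE eq_sym (negPf l_nu) => ->; rewrite scale0r.
rewrite dirac_operator_hproj //.
(* Covariance: in front of [t], the new operator is the old one multiplied by [S] on the left and
   [E^b] on the right. *)
transitivity (S * (dirac_operator m A x * hproj) * c); last first.
  by rewrite eq0 mul0r mulr0 mul0r.
have rot W : S * (W * hproj) * c = S * W * c * hproj by rewrite -!mulrA c_proj.
rewrite dirac_operator_hproj // rot [LHS]mulrDl mulrDr ![in RHS]mulrDl.
congr (_ + _); last first.
  rewrite -scalerAr -!scalerAl; congr (_ *: _).
  rewrite -[LHS]mulrA I_proj mulrA spinor_map_hproj //.
  by rewrite -!mulrA -I_proj !mulrA; congr (_ * _); rewrite -!mulrA c_I.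
rewrite mulr_suml mulr_sumr !mulr_suml.
transitivity (\sum_mu \sum_nu invmx P nu mu *: (gen R mu * S * (A nu * c * E * hproj))).
  apply: eq_bigr => mu _; rewrite -mulrA E_proj mulrA -[_ * _ * hproj]mulrA AhatE.
  rewrite mulr_sumr mulr_suml; apply: eq_bigr => nu _.
  rewrite -scalerAr -scalerAl; congr (_ *: _).
  by rewrite -!mulrA -E_proj.
rewrite exchange_big /=; apply: eq_bigr => nu _.
under eq_bigr => mu _ do rewrite scalerAl.
by rewrite -mulr_suml genS -!mulrA (mulrA c) c_E -!mulrA.
Qed.

End SpinorMap.
End Projector.
From mathcomp Require Import all_classical all_reals all_analysis.
Import numFieldNormedType.Exports.
Local Open Scope ring_scope.

(** * Derivatives of finite linear combinations *)

Section LinearCombination.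
Variables (R : realType) (V : normedModType R) (J : finType).
Variables (k : J -> R) (f : J -> V -> R^o) (x : V).
Hypothesis df : forall j, differentiable (f j) x.

Lemma lincomb_differentiable_derive :
  differentiable (fun y => \sum_j k j * f j y : R^o) x /\
  forall v, 'D_v (fun y => \sum_j k j * f j y : R^o) x = \sum_j k j * 'D_v (f j) x.
Proof.
elim: (index_enum J) => [|j r [dr Dr]].
  rewrite (_ : (fun _ => _) = cst 0); last by apply/funext=> y; rewrite big_nil.
  by split=> [|v]; [exact: differentiable_cst | rewrite derive_cst big_nil].
set g := fun y => _ in dr Dr.
rewrite (_ : (fun _ => _) = k j \*: f j + g); last first.
  by apply/funext=> y; rewrite big_cons.
have dkf : differentiable (k j \*: f j) x by apply: differentiableZ.
split=> [|v]; first exact: differentiableD.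
rewrite big_cons deriveD; [|exact: diff_derivable..].
by rewrite Dr deriveZ //; apply: diff_derivable.
Qed.

End LinearCombination.

(** * Clifford-valued functions under linear maps of values and of arguments *)

Section CliffordCalculus.
Variables (R : realType) (n : nat).
Local Notation Cl := (clifford R n).
Local Notation spacetime := 'cV[R]_n.+1.

(** Differentiability is defined coefficientwise, so a linear map is used through its matrix in the
    blade basis. *)
Lemma linear_coord (L : {linear Cl -> Cl}) (x : Cl) A :
  L x A = \sum_B L (basis_blade R B) A * x B.
Proof.
rewrite {1}[x]sum_basis_blade (raddf_sum L) sum_ffunE; apply: eq_bigr => B _.
by rewrite /= linearZ ffunE mulrC.
Qed.

Lemma linear_coord_fun (L : {linear Cl -> Cl}) (F : spacetime -> Cl) A :
  (fun y => L (F y) A) = (fun y => \sum_B L (basis_blade R B) A * F y B).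
Proof. by apply/funext=> y; rewrite linear_coord. Qed.

Lemma cl_differentiable_linear (L : {linear Cl -> Cl}) (F : spacetime -> Cl) :
  cl_differentiable F -> cl_differentiable (fun y => L (F y)).
Proof.
move=> dF A x; rewrite linear_coord_fun.
by have [] := lincomb_differentiable_derive (fun B => L (basis_blade R B) A)
  (fun B => dF B x).
Qed.

Lemma partial_linear (L : {linear Cl -> Cl}) (F : spacetime -> Cl) mu x :
  cl_differentiable F -> partial mu (fun y => L (F y)) x = L (partial mu F x).
Proof.
move=> dF; apply/ffunP=> A; rewrite [RHS]linear_coord ffunE linear_coord_fun.
have [_ ->] := lincomb_differentiable_derive (fun B => L (basis_blade R B) A)
  (fun B => dF B x).
by apply: eq_bigr => B _; rewrite ffunE.
Qed.

Lemma differentiable_mulmx (Q : 'M[R]_n.+1) (x : spacetime) :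
  differentiable (mulmx Q : spacetime -> spacetime) x.
Proof.
(* Each summand is a coordinate function followed by scaling of a fixed column. *)
have -> : mulmx Q = \sum_j (fun y : spacetime => y j 0 *: col j Q).
  apply/funext=> y; rewrite fct_sumE; apply/colP=> i; rewrite summxE !mxE.
  by apply: eq_bigr => j _; rewrite !mxE mulrC.
apply: (big_ind (fun g => differentiable g x)) => [|g h|j _].
- exact: differentiable_cst.
- exact: differentiableD.
- exact: (@differentiable_comp _ _ _ _ (fun y : spacetime => y j 0 : R^o)
    ( *:%R^~ (col j Q)) x (differentiable_coord _ _ _)).
Qed.

Lemma cl_differentiable_mulmx (Q : 'M[R]_n.+1) (F : spacetime -> Cl) :
  cl_differentiable F -> cl_differentiable (fun y => F (Q *m y)).
Proof.
move=> dF A x.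
apply: (@differentiable_comp _ _ _ _ (mulmx Q) (fun z => F z A : R^o)).
  exact: differentiable_mulmx.
exact: dF.
Qed.

End CliffordCalculus.

(** * From the pointwise identity to solutions of the equation *)

Section Transformation.
Variables (R : realType) (d : nat).
Hypothesis d_ge2 : (2 <= d)%N.
Local Notation n := (2 * d - 1)%N.
Local Notation Cl := (clifford R n).
Local Notation spacetime := 'cV[R]_n.+1.
Local Notation I := (elt_I R d).
Local Notation E := (elt_E R d).

(** The conditions defining [qeven] are invariance under linear maps, which commute with partial
    derivatives. *)
Lemma qeven_partial (F : spacetime -> Cl) mu x :
  cl_differentiable F -> (forall y, qeven (F y)) -> qeven (partial mu F x).
Proof.
move=> dF eF.
have fixF C : (forall y, flip C (F y) = F y) ->
    flip C (partial mu F x) = partial mu F x.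
  move=> fF; rewrite -(partial_linear (flip C)) //=.
  by congr (partial _ _ _); apply/funext.
split=> [nu nq|]; apply: fixF => y; last by case: (eF y).
by case: (eF y) => fFy _; apply: fFy.
Qed.

Lemma spinor_map_solution (P : 'M[R]_n.+1) (S S0 : Cl)
    (Sc : {set 'I_n.+1} -> Cl) (b : bool) (m : R) (a : spacetime -> 'rV[R]_n.+1)
    (Psi : spacetime -> Cl) :
  in_lorentz P -> S \is a GRing.unit -> S \in parity_part R n b ->
  (forall mu, S^-1 * gen R mu * S = \sum_nu P mu nu *: gen R nu) ->
  q_decomposition S S0 Sc -> admissible Psi -> dirac_hestenes m a Psi ->
  let Psihat y := spinor_map S0 Sc b (Psi (invmx P *m y)) in
  admissible Psihat /\
  transformed_dirac_hestenes m (hat_partial P) (hat_potential P a) (@gen R n) Psihat.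
Proof.
move=> PO Su pS SP S_dec [dPsi qPsi] eqPsi Psihat.
have Pu := lorentz_unit PO; set L := (spinor_map S0 Sc b : {linear Cl -> Cl}).
have ePsi y : qeven (Psi y) by apply: qeven_qalg_even.
have LE x : qeven x -> qeven (L x).
  exact: (spinor_map_qeven d_ge2 S_dec pS).
split.
  split=> [|y]; last by apply: (spinor_map_even d_ge2 S_dec).
  apply: (@cl_differentiable_mulmx _ _ _ (fun z => L (Psi z))).
  exact: (cl_differentiable_linear L).
move=> y; set x := invmx P *m y.
have eD nu : qeven (partial nu Psi x) by apply: qeven_partial.
(* In the old coordinates the change of argument cancels, so the hatted derivatives are computed by
   linearity of [L] alone. *)
have Psihat_P : (fun z => Psihat (P *m z)) = (fun z => L (Psi z)).
  by apply/funext=> z; rewrite /Psihat mulKmx.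
have hatE mu : hat_partial P mu Psihat y =
    \sum_nu invmx P nu mu *: L (partial nu Psi x).
  rewrite /hat_partial Psihat_P; apply: eq_bigr => nu _.
  by congr (_ *: _); apply: (partial_linear L).
have eLD nu : qeven (spinor_map S0 Sc b (partial nu Psi x)) by apply: LE.
have eLPsi : qeven (spinor_map S0 Sc b (Psi x)) by apply: LE.
have eq_x : dirac_operator m
    (fun mu => partial mu Psi x + a x 0 mu *: (Psi x * I)) (Psi x) = 0.
  exact: eqPsi.
have := dirac_operator_spinor_map d_ge2 S_dec Pu Su SP eD (ePsi x) eLD eLPsi eq_x.
pose Ahat mu :=
  hat_partial P mu Psihat y + hat_potential P a y 0 mu *: (Psihat y * I).
suff -> : (fun mu =>
    \sum_nu invmx P nu mu *: spinor_map S0 Sc b (partial nu Psi x) +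
    (\sum_nu invmx P nu mu * a x 0 nu) *: (spinor_map S0 Sc b (Psi x) * I)) = Ahat.
  by rewrite -dirac_operator_transformed.
by apply/funext=> mu; rewrite /Ahat hatE mxE.
Qed.

End Transformation.

Unset Implicit Arguments.

Theorem theorem5p4 (R : realType) (d : nat) (d_ge2 : (2 <= d)%N)
    (P : 'M[R]_((2 * d - 1).+1)) (P_O : in_lorentz P)
    (S : clifford R (2 * d - 1)) (S_pin : in_pin S)
    (S_P : forall mu : 'I_((2 * d - 1).+1),
       S^-1 * gen R mu * S = \sum_nu P mu nu *: gen R nu)
    (S0 : clifford R (2 * d - 1))
    (Sc : {set 'I_((2 * d - 1).+1)} -> clifford R (2 * d - 1))
    (S_dec : q_decomposition S S0 Sc)
    (m : R) (a : 'cV[R]_((2 * d - 1).+1) -> 'rV[R]_((2 * d - 1).+1))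
    (Psi : 'cV[R]_((2 * d - 1).+1) -> clifford R (2 * d - 1))
    (Psi_adm : admissible Psi) (Psi_sol : dirac_hestenes m a Psi) :
  let Q := invmx P in
  let I := elt_I R d in
  let E := elt_E R d in
  let ehat (mu : 'I_((2 * d - 1).+1)) := gen R mu in
  (in_spin S ->
   let Psihat (y : 'cV[R]_((2 * d - 1).+1)) :=
     S0 * Psi (Q *m y) +
     \sum_(M | multi_index M)
        Sc M * Psi (Q *m y) * shifted_blade R M * I ^+ #|M| in
   admissible Psihat /\
   transformed_dirac_hestenes m (hat_partial P) (hat_potential P a) ehat
     Psihat) /\
  (~ in_spin S ->
   let Psihat (y : 'cV[R]_((2 * d - 1).+1)) :=
     S0 * Psi (Q *m y) * E +
     \sum_(M | multi_index M)
        Sc M * Psi (Q *m y) * shifted_blade R M * I ^+ #|M| * E in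
   admissible Psihat /\
   transformed_dirac_hestenes m (hat_partial P) (hat_potential P a) ehat
     Psihat).
Proof.
move=> Q I E ehat; have [S_unit S_parity _ _] := S_pin.
split=> [[_ S_even] Psihat|S_not_spin Psihat].
  have -> : Psihat = fun y => spinor_map S0 Sc false (Psi (Q *m y)).
    by apply/funext=> y; rewrite /spinor_map expr0 mulr1.
  exact: (spinor_map_solution d_ge2 P_O S_unit S_even S_P S_dec Psi_adm Psi_sol).
have -> : Psihat = fun y => spinor_map S0 Sc true (Psi (Q *m y)).
  by apply/funext=> y; rewrite /spinor_map expr1 mulrDl mulr_suml.
(* An element of Pin is even or odd, and an even one would lie in Spin. *)
have S_odd : S \in odd_part R (2 * d - 1).
  by case: S_parity => // S_even; case: S_not_spin.
exact: (spinor_map_solution d_ge2 P_O S_unit S_odd S_P S_dec Psi_adm Psi_sol).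
Qed.
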